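(* As a tariff parametrized by $F\in\mathbb{R}$, the optimal two-part tariff $T^*$ induces an expected total surplus $\overline{\mathsf{sw}}^*:=\overline{\mathsf{sw}}(T^* )=\overline{\mathsf{cs}}(T^* )+\overline{\mathsf{rs}}(T^* )$ that is independent of $F$, and $\overline{\mathsf{cs}}(T^* )=\overline{\mathsf{sw}}^*-F$.
   Context: Model. Fix integers $N,M\ge 1$. $\lambda$ is a random vector in $\mathbb{R}_+^N$ (wholesale prices) and, for $i=1,\dots,M$, $\omega^i=(\omega^i_1,\dots,\omega^i_N)$ is a random vector in $\mathbb{R}^N$ (local state of customer $i$); $\omega=(\omega^1,\dots,\omega^M)$; the joint law of $(\lambda,\omega)$ is arbitrary. An overline denotes expectation, e.g. $\overline{\lambda}=\mathbb{E}[\lambda]$. Customer $i$ has a gross surplus function $S^i:\mathbb{R}^N\times\mathbb{R}^N\to\mathbb{R}$, $(q^i,\omega^i)\mapsto S^i(q^i,\omega^i)$, continuously differentiable. A (ex-ante) tariff is a deterministic function $T:\mathbb{R}^N\to\mathbb{R}$. A causal policy is a map $\omega^i\mapsto q^i(\omega^i)\in\mathbb{R}^N$ whose $k$-th component depends only on $(\omega^i_1,\dots,\omega^i_k)$. Given $T$, customer $i$'s consumption $q^i(T,\omega^i)$ is a causal policy maximizing $\mathbb{E}[S^i(q^i(\omega^i),\omega^i)-T(q^i(\omega^i))]$. (Every customer pays the charge $T$; no customer opts out.) Define the expected consumer, retailer and total surplus $$\overline{\mathsf{cs}}(T)=\mathbb{E}\Big[\sum_{i=1}^M S^i(q^i(T,\omega^i),\omega^i)-T(q^i(T,\omega^i))\Big],\quad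 \overline{\mathsf{rs}}(T)=\mathbb{E}\Big[\sum_{i=1}^M T(q^i(T,\omega^i))-\lambda^\top q^i(T,\omega^i)\Big],$$ $\overline{\mathsf{sw}}(T)=\overline{\mathsf{cs}}(T)+\overline{\mathsf{rs}}(T)$. Demand. For affine tariffs $T(q)=A+\pi^\top q$ it is assumed that $q^i(T,\omega^i)$ depends on $T$ only through $\pi$, and one writes $D^i(\pi,\omega^i)=q^i(T,\omega^i)$. It is assumed that $D^i$ is componentwise nonnegative, continuously differentiable in $\pi$, and that $\nabla_\pi D^i$ is negative definite ($x^\top(\nabla_\pi D^i)x<0$ for all $x\ne0$; symmetry is not required). $D(\pi,\omega)=\sum_{i=1}^M D^i(\pi,\omega^i)$. Convention: in products with vectors, the $N\times N$ matrix $\nabla_\pi D$ has $(k,t)$ entry $\partial D_t/\partial\pi_k$. All expectations are assumed finite and differentiation may be exchanged with expectation. Define $\overline{\phi}(\pi)=\mathbb{E}[(\pi-\lambda)^\top D(\pi,\omega)]$. Standing assumption (Assumption 1): $g(\pi)=\mathbb{E}[\nabla_\pi D(\pi,\omega)(\pi-\lambda)]$ has a negative definite Jacobian matrix $\nabla g(\pi)$ for all $\pi$. Optimal two-part tariff for target $F$: $T^*(q)=A^*+\pi^{*\top}q$ is the maximizer of $\overline{\mathsf{cs}}(T)$ subject to $\overline{\mathsf{rs}}(T)=F$ over all $T(q)=A+\pi^\top q$ with $A\in\mathbb{R},\pi\in\mathbb{R}^N$; it is characterized by $\pi^*=\overline{\lambda}+\mathbb{E}[\nabla_\pi D(\pi^*,\omega)]^{-1}\mathbb{E}[\nabla_\pi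 D(\pi^*,\omega)(\lambda-\overline{\lambda})]$ and $A^*=\frac1M(F-\overline{\phi}(\pi^* ))$. *)

(* Defs.v *)
(* MathComp / MathComp-Analysis. *)
From HB Require Import structures.
From mathcomp Require Import all_boot all_order all_algebra.
From mathcomp Require Import all_classical all_reals all_analysis.

Set Implicit Arguments.
Unset Strict Implicit.
Unset Printing Implicit Defensive.

Import Order.TTheory GRing.Theory Num.Theory.
Import numFieldNormedType.Exports.

Local Open Scope classical_set_scope.
Local Open Scope ring_scope.

Definition dotv {R : realType} {N : nat} (u v : 'rV[R]_N) : R :=
  \sum_(k < N) u 0 k * v 0 k.

(* No symmetry is required. *)
Definition neg_def {R : realType} {N : nat} (B : 'M[R]_N) : Prop :=
  forall x : 'rV[R]_N, x != 0 -> (x *m B *m x^T) 0 0 < 0.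

(* In finite dimension, continuity of the derivative amounts to continuity of
   every directional derivative. *)
Definition continuously_differentiable {R : realType}
    {V W : normedModType R} (f : V -> W) : Prop :=
  (forall x, differentiable f x) /\
  (forall v, continuous (fun x => 'D_v f x)).

Definition affine_tariff {R : realType} {N : nat} (A : R) (pi : 'rV[R]_N) :
    'rV[R]_N -> R :=
  fun q => A + dotv pi q.

(* The k-th component only looks at the components 0, ..., k of the state. *)
Definition causal {R : realType} {N : nat} (p : 'rV[R]_N -> 'rV[R]_N) : Prop :=
  forall (k : 'I_N) (o o' : 'rV[R]_N),
    (forall j : 'I_N, (j <= k)%N -> o 0 j = o' 0 j) -> p o 0 k = p o' 0 k.

(* [response i T] is the consumption q^i(T, .) chosen under the tariff T, and
   [demand i pi] is D^i(pi, .). *)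
Record market {d : measure_display} {Omega : measurableType d} {R : realType}
    (P : probability Omega R) (N M : nat) := Market {
  wholesale : 'I_N -> {RV P >-> R};
  state : 'I_M -> 'I_N -> {RV P >-> R};
  surplus : 'I_M -> 'rV[R]_N -> 'rV[R]_N -> R;
  response : 'I_M -> ('rV[R]_N -> R) -> 'rV[R]_N -> 'rV[R]_N;
  demand : 'I_M -> 'rV[R]_N -> 'rV[R]_N -> 'rV[R]_N }.

Section Market.
Context {d : measure_display} {Omega : measurableType d} {R : realType}.
Context {P : probability Omega R} {N M : nat}.
Implicit Types (m : market P N M) (i : 'I_M) (pi : 'rV[R]_N) (w : Omega).
Implicit Types (T : 'rV[R]_N -> R) (p : 'rV[R]_N -> 'rV[R]_N).

Definition mean (X : Omega -> R) : R := fine ('E_P[X]).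

Definition has_mean (X : Omega -> R) : Prop := P.-integrable setT (EFin \o X).

Definition lambda m w : 'rV[R]_N := \row_k wholesale m k w.

Definition omega m i w : 'rV[R]_N := \row_k state m i k w.

Definition net_surplus m i T p w : R :=
  surplus m i (p (omega m i w)) (omega m i w) - T (p (omega m i w)).

(* Measurability is imposed on the resulting random consumption. *)
Definition admissible m i T p : Prop :=
  [/\ causal p,
      forall k, measurable_fun setT (fun w => p (omega m i w) 0 k)
    & has_mean (net_surplus m i T p)].

Definition optimal_policy m i T p : Prop :=
  admissible m i T p /\
  forall p', admissible m i T p' ->
    mean (net_surplus m i T p') <= mean (net_surplus m i T p).

Definition cs m T : R :=
  mean (fun w => \sum_(i < M) net_surplus m i T (response m i T) w).

Definition rs m T : R :=
  mean (fun w => \sum_(i < M)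
    (T (response m i T (omega m i w)) -
     dotv (lambda m w) (response m i T (omega m i w)))).

Definition sw m T : R := cs m T + rs m T.

Definition total_demand m pi w : 'rV[R]_N :=
  \sum_(i < M) demand m i pi (omega m i w).

(* ['J f pi] has (k, t) entry the partial derivative of the t-th component of f
   in the k-th coordinate of pi. *)
Definition grad_demand m pi w : 'M[R]_N :=
  'J (fun pi' => total_demand m pi' w) pi.

Definition margin m pi w : R := dotv (pi - lambda m w) (total_demand m pi w).

Definition g m pi : 'rV[R]_N :=
  \row_k mean (fun w => (grad_demand m pi w *m (pi - lambda m w)^T) k 0).

(* Every customer best-responds to any tariff for which a best response exists,
   and one exists for affine tariffs.  (It does not for arbitrary tariffs.) *)
Definition rational_response m : Prop :=
  (forall i T, (exists p, optimal_policy m i T p) ->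
     optimal_policy m i T (response m i T)) /\
  (forall i A pi, exists p, optimal_policy m i (affine_tariff A pi) p).

Definition response_is_demand m : Prop :=
  forall i A pi o, response m i (affine_tariff A pi) o = demand m i pi o.

(* [Prices := setT] is nonnegativity at every price.  A subset is allowed because,
   for N = 1, a demand that is nonnegative on the whole line is incompatible with
   a continuously differentiable surplus on all of R (the marginal surplus equals
   the price), and linear demands are nonnegative on part of the space only. *)
Definition nonneg_demand m (Prices : set 'rV[R]_N) : Prop :=
  forall i pi w k, Prices pi -> 0 <= demand m i pi (omega m i w) 0 k.

Definition finite_means m : Prop :=
  [/\ forall k, has_mean (wholesale m k),
      forall i pi k, has_mean (fun w => demand m i pi (omega m i w) 0 k),
      forall i pi,
        has_mean (fun w => dotv (lambda m w) (demand m i pi (omega m i w))),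
      forall i pi, has_mean
        (fun w => surplus m i (demand m i pi (omega m i w)) (omega m i w))
    & forall pi k t,
        has_mean (fun w => grad_demand m pi w k t) /\
        has_mean (fun w => grad_demand m pi w k t * wholesale m t w)].

Definition diff_under_mean (f : 'rV[R]_N -> Omega -> R) : Prop :=
  (forall pi, differentiable (fun pi' => mean (f pi')) pi) /\
  forall pi v, has_mean (fun w => 'D_v (fun pi' => f pi' w) pi) /\
    'D_v (fun pi' => mean (f pi')) pi =
    mean (fun w => 'D_v (fun pi' => f pi' w) pi).

Definition exchange m : Prop :=
  [/\ forall t, diff_under_mean (fun pi w => total_demand m pi w 0 t),
      diff_under_mean (margin m)
    & forall i, diff_under_mean (fun pi w =>
        surplus m i (demand m i pi (omega m i w)) (omega m i w))].

Definition optimal_two_part m (F A : R) pi : Prop :=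
  rs m (affine_tariff A pi) = F /\
  forall A' pi', rs m (affine_tariff A' pi') = F ->
    cs m (affine_tariff A' pi') <= cs m (affine_tariff A pi).

End Market.

(* Main.v *)
(** The fixed charge A only moves A *+ M from consumers to the retailer, so the
    total surplus of an affine tariff depends on its price pi alone, and A can be
    adjusted to meet any target F at any price.  An optimal price therefore
    maximizes the total surplus over all prices, whatever F is, and any two
    optimal prices have the same total surplus. *)
Require Import Defs.
From mathcomp Require Import all_boot all_order all_algebra.
From mathcomp Require Import all_classical all_reals all_analysis.
Import Order.TTheory GRing.Theory Num.Theory.
Import numFieldNormedType.Exports.
Local Open Scope classical_set_scope.
Local Open Scope ring_scope.

Set Implicit Arguments.
Unset Strict Implicit.
Unset Printing Implicit Defensive.

Section Means.
Context {d : measure_display} {Omega : measurableType d} {R : realType}.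
Context {P : probability Omega R}.

Lemma has_meanZ (a : R) (X : Omega -> R) :
  has_mean (P := P) X -> has_mean (P := P) (fun w => a * X w).
Proof. by move=> hX; have := integrableZl measurableT a hX. Qed.

Lemma has_meanB (X Y : Omega -> R) :
  has_mean (P := P) X -> has_mean (P := P) Y ->
  has_mean (P := P) (fun w => X w - Y w).
Proof. by move=> hX hY; have := integrableB measurableT hX hY. Qed.

Lemma has_mean_sum (I : finType) (X : I -> Omega -> R) :
  (forall i, has_mean (P := P) (X i)) ->
  has_mean (P := P) (fun w => \sum_i X i w).
Proof.
move=> hX.
have := integrable_sum (mu := P) measurableT (index_enum I) (P := xpredT)
  (fun i _ => hX i).
by apply: (eq_integrable measurableT) => w _; rewrite /= sumEFin.
Qed.

Lemma has_mean_cst (c : R) : has_mean (P := P) (cst c).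
Proof. exact: finite_measure_integrable_cst. Qed.

Lemma has_mean_dotv (N : nat) (pi : 'rV[R]_N) (X : Omega -> 'rV[R]_N) :
  (forall k, has_mean (P := P) (fun w => X w 0 k)) ->
  has_mean (P := P) (fun w => dotv pi (X w)).
Proof. by move=> hX; apply: has_mean_sum => k; apply: has_meanZ. Qed.

(** [P] has total mass 1, so the constant integrates to itself. Integrability of [X] keeps both
    integrals finite, and there [fine] is additive. *)
Lemma mean_addr_cst (X : Omega -> R) (c : R) : has_mean (P := P) X ->
  mean (P := P) (fun w => X w + c) = mean (P := P) X + c.
Proof.
move=> hX; rewrite /mean unlock.
under eq_integral do rewrite EFinD.
rewrite integralD //=; last exact: has_mean_cst.
have -> : (\int[P]_x c%:E = c%:E)%E.
  by rewrite integral_cst // [X in (_ * X)%E]probability_setT mule1.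
by rewrite fineD //; exact: integrable_fin_num.
Qed.

End Means.

Section AffineTariffs.
Context {d : measure_display} {Omega : measurableType d} {R : realType}.
Context {P : probability Omega R} {N M : nat}.
Context (m : market P N M).
Context (respD : response_is_demand m) (fin_m : finite_means m).
Implicit Types (A : R) (pi : 'rV[R]_N).

(** By [respD] consumption reacts to the price only, so the charge enters each customer's net
    surplus as the same additive constant. *)
Lemma cs_affine A pi :
  cs m (affine_tariff A pi) = cs m (affine_tariff 0 pi) - A *+ M.
Proof.
case: fin_m => _ hD _ hS _.
rewrite /cs -mean_addr_cst; last first.
  apply: has_mean_sum => i; rewrite /net_surplus /affine_tariff.
  under eq_fun do rewrite respD add0r.
  by apply: has_meanB => //; apply: has_mean_dotv.
congr mean; apply/funext => w.
(* Spreading [A *+ M] over the customers makes the identity termwise. *)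
rewrite -[M in A *+ M]card_ord -sumr_const -sumrB.
apply: eq_bigr => i _.
by rewrite /net_surplus !respD /affine_tariff add0r opprD addrA addrAC.
Qed.

Lemma rs_affine A pi :
  rs m (affine_tariff A pi) = rs m (affine_tariff 0 pi) + A *+ M.
Proof.
case: fin_m => _ hD hL _ _.
rewrite /rs -mean_addr_cst; last first.
  apply: has_mean_sum => i; rewrite /affine_tariff.
  under eq_fun do rewrite respD add0r.
  by apply: has_meanB => //; apply: has_mean_dotv.
congr mean; apply/funext => w.
rewrite -[M in A *+ M]card_ord -sumr_const -big_split /=.
apply: eq_bigr => i _.
by rewrite !respD /affine_tariff add0r -addrA addrC.
Qed.

Lemma sw_affine A pi :
  sw m (affine_tariff A pi) = sw m (affine_tariff 0 pi).
Proof. by rewrite /sw cs_affine rs_affine addrACA addNr addr0. Qed.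

(** The target [F] is absent from the conclusion, which lets optima for different targets be
    compared. *)
Lemma optimal_two_part_sw F A pi pi' : (0 < M)%N ->
  optimal_two_part m F A pi ->
  sw m (affine_tariff 0 pi') <= sw m (affine_tariff 0 pi).
Proof.
move=> M0 [rsF opt].
(* On the constraint set the objective differs from the total surplus by the constant [F] only. *)
have csE A1 pi1 : rs m (affine_tariff A1 pi1) = F ->
    cs m (affine_tariff A1 pi1) = sw m (affine_tariff 0 pi1) - F.
  by move=> rsF1; rewrite -(sw_affine A1) /sw rsF1 addrK.
(* The charge that solves [rs m (affine_tariff 0 pi') + A' *+ M = F]; solvable since [M] is
   positive. *)
pose A' := (F - rs m (affine_tariff 0 pi')) / M%:R.
have rsA' : rs m (affine_tariff A' pi') = F.
  by rewrite rs_affine -mulr_natr divfK ?pnatr_eq0 -?lt0n// addrC subrK.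
by have := opt _ _ rsA'; rewrite !csE // lerD2r.
Qed.

End AffineTariffs.

Theorem corollary2 (d : measure_display) (Omega : measurableType d)
    (R : realType) (P : probability Omega R) (N M : nat) (m : market P N M)
    (Prices : set 'rV[R]_N) :
  (0 < N)%N -> (0 < M)%N ->
  (forall k w, 0 <= wholesale m k w) ->
  (forall i, continuously_differentiable
     (fun z : 'rV[R]_N * 'rV[R]_N => surplus m i z.1 z.2)) ->
  rational_response m ->
  response_is_demand m ->
  nonneg_demand m Prices ->
  (forall i w, continuously_differentiable
     (fun pi => demand m i pi (omega m i w))) ->
  (forall i w pi, neg_def ('J (fun pi' => demand m i pi' (omega m i w)) pi)) ->
  finite_means m ->
  exchange m ->
  (forall pi, differentiable (g m) pi /\ neg_def ('J (g m) pi)) ->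
  exists sw_star : R, forall (F A : R) (pi : 'rV[R]_N),
    optimal_two_part m F A pi ->
    sw m (affine_tariff A pi) = sw_star /\
    cs m (affine_tariff A pi) = sw_star - F.
Proof.
move=> _ M0 _ _ _ respD _ _ _ fin_m _ _.
(* The witness must be fixed before [F], so it is read off one optimal tariff for an arbitrary
   target [F0]. If no target has an optimum, the claim is vacuous and 0 is a dummy value. *)
have [[[[F0 A0] pi0] opt0]|none] := pselect (exists z : R * R * 'rV[R]_N,
    optimal_two_part m z.1.1 z.1.2 z.2); last first.
  by exists 0 => F A pi opt; case: none; exists (F, A, pi).
exists (sw m (affine_tariff 0 pi0)) => F A pi opt.
have swE : sw m (affine_tariff A pi) = sw m (affine_tariff 0 pi0).
  (* Antisymmetry: each of the two optimal prices does at least as well as the other, although [F]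
     and [F0] may differ. *)
  rewrite sw_affine //; apply/eqP; rewrite eq_le.
  rewrite (optimal_two_part_sw respD fin_m pi M0 opt0).
  by rewrite (optimal_two_part_sw respD fin_m pi0 M0 opt).
by split=> //; case: opt => rsF _; rewrite -swE /sw rsF addrK.
Qed.
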